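(* Let $\mathbb{R}^n$ and $\mathbb{R}^m$ be equipped with arbitrary norms $\|\cdot\|$, with dual norms $\|\cdot\|_*$, and let $g:\mathbb{R}^n\to\mathbb{R}^m$, $y\in\mathbb{R}^m$, $\rho>0$, $L>0$, $\mu_0>0$. Let $B=\{x\in\mathbb{R}^n:\|x\|\le\rho\}$. Assume: (A) $g(0)=0$, $g$ is differentiable in $B$, and $\|g'(x^a)-g'(x^b)\|\le L\|x^a-x^b\|$ for all $x^a,x^b\in B$; (B') $\|g'(0)^T h\|_*\ge\mu_0\|h\|_*$ for all $h\in\mathbb{R}^m$; (C') $\|y\|<\frac{\mu_0^2}{4L}$ and $\frac{\mu_0}{2L}\le\rho$. Then there exists a solution $x^*$ of $g(x)=y$ with $\|x^*\|\le\frac{2\|y\|}{\mu_0}$.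
   Context: For a vector $c$, the dual norm is $\|c\|_*=\sup_{\|x\|=1}(c,x)$. The norm of $g'(x)$ is the operator norm subordinate to the chosen vector norms. *)

(* Defs.v *)
From HB Require Import structures.
From mathcomp Require Import all_boot all_order all_algebra.
From mathcomp Require Import classical_sets boolp reals.
Set Implicit Arguments. Unset Strict Implicit. Unset Printing Implicit Defensive.
Import Order.TTheory GRing.Theory Num.Theory.
Local Open Scope ring_scope.
Local Open Scope classical_set_scope.

Section Norms.
Variable R : realType.

Definition is_norm (k : nat) (N : 'rV[R]_k -> R) : Prop :=
  [/\ (forall x, 0 <= N x),
      (forall x, N x = 0 -> x = 0),
      (forall (a : R) x, N (a *: x) = `|a| * N x) &
      (forall x y, N (x + y) <= N x + N y)].

Definition pairing (k : nat) (c x : 'rV[R]_k) : R := \sum_(i < k) c 0 i * x 0 i.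

Definition dual_norm (k : nat) (N : 'rV[R]_k -> R) (c : 'rV[R]_k) : R :=
  sup [set pairing c x | x in [set x | N x = 1]].

Definition op_norm (n m : nat) (Nn : 'rV[R]_n -> R) (Nm : 'rV[R]_m -> R)
  (A : 'M[R]_(n, m)) : R :=
  sup [set Nm (x *m A) | x in [set x | Nn x = 1]].

Definition has_derivative_at (n m : nat) (Nn : 'rV[R]_n -> R) (Nm : 'rV[R]_m -> R)
  (g : 'rV[R]_n -> 'rV[R]_m) (x : 'rV[R]_n) (J : 'M[R]_(n, m)) : Prop :=
  forall eps : R, 0 < eps -> exists2 delta : R, 0 < delta &
    forall h : 'rV[R]_n, Nn h <= delta ->
      Nm (g (x + h) - g x - h *m J) <= eps * Nn h.

End Norms.

(* Main.v *)
(* Minimise phi(x) = |y - g(x)| + (mu0/2)|x| over the compact ball |x| <= rho.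
   Comparing with phi(0) = |y|, a minimiser x satisfies
   |x| <= 2|y|/mu0 < mu0/(2L) <= rho. If w = y - g(x) were nonzero, (B') and
   duality would give u with g'(0)u = w and mu0|u| <= |w|; to first order in t,
   phi(x + tu) - phi(x) <= t(-|w| + (L|x| + mu0/2)|u|), which is negative
   because L|x| < mu0/2. *)
Require Import Defs.
From HB Require Import structures.
From mathcomp Require Import all_boot all_order all_algebra.
From mathcomp Require Import classical_sets boolp reals.
From mathcomp Require Import topology normedtype derive.
From mathcomp Require Import ring lra.
Import Order.TTheory GRing.Theory Num.Def Num.Theory.
Import numFieldNormedType.Exports.
Local Open Scope ring_scope.

(** * Norms on row vectors: equivalence, compact balls, suprema over unit spheres *)

Section NormLemmas.
Local Open Scope classical_set_scope.
Context {R : realType}.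

Lemma cvg_mx_norm {k} (f : 'rV[R]_k -> R) (x : 'rV[R]_k) :
  (forall e, 0 < e ->
     exists2 d, 0 < d & forall z, `|x - z| < d -> `|f x - f z| <= e) ->
  f @ x --> f x.
Proof.
move=> fx; apply/(@cvgrPdist_le _ _ _ _ (nbhs_filter x)) => e /fx[d d0 dP].
apply/(@nbhs_ballP R 'rV[R]_k x); exists d => //= z.
by rewrite mx_norm_ball => /dP.
Qed.

(** Definiteness is dropped so that the bounds below also cover [x |-> Nm (x *m A)] and the absolute
    value of a linear form, which may vanish at nonzero vectors. *)
Definition seminorm {k} (p : 'rV[R]_k -> R) : Prop :=
  [/\ forall x, 0 <= p x,
      forall (a : R) x, p (a *: x) = `|a| * p x &
      forall x y, p (x + y) <= p x + p y].

Lemma norm_seminorm {k} {N : 'rV[R]_k -> R} : is_norm N -> seminorm N.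
Proof. by case. Qed.

Section Seminorm.
Context {k : nat} {p : 'rV[R]_k -> R} (sp : seminorm p).

Lemma semi_ge0 x : 0 <= p x. Proof. by case: sp. Qed.
Lemma semiZ a x : p (a *: x) = `|a| * p x. Proof. by case: sp. Qed.
Lemma semiD x y : p (x + y) <= p x + p y. Proof. by case: sp. Qed.

Lemma semi0 : p 0 = 0.
Proof. by rewrite -(scale0r 0) semiZ normr0 mul0r. Qed.

Lemma semiN x : p (- x) = p x.
Proof. by rewrite -scaleN1r semiZ normrN normr1 mul1r. Qed.

Lemma semi_dist x y : `|p x - p y| <= p (x - y).
Proof.
have xy : p x <= p (x - y) + p y by rewrite -{1}(subrK y x); exact: semiD.
have yx : p y <= p (y - x) + p x by rewrite -{1}(subrK x y); exact: semiD.
by rewrite -(opprB x y) semiN in yx; rewrite ler_norml; apply/andP; split; lra.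
Qed.

(** Expand [x] in the standard basis and bound each coordinate by the max norm; the added 1 keeps
    the constant positive even when [p] vanishes. *)
Lemma semi_le_mx_norm : exists2 C, 0 < C & forall x, p x <= C * `|x|.
Proof.
exists (1 + \sum_i p (delta_mx 0 i)).
  by rewrite ltr_pwDl ?ltr01 // sumr_ge0 // => i _; exact: semi_ge0.
move=> x; apply: (@le_trans _ _ (\sum_i `|x 0 i| * p (delta_mx 0 i))).
  rewrite {1}(row_sum_delta x).
  elim/big_ind2 : _ => [|a b c d ab cd|i _]; first by rewrite semi0.
    exact: le_trans (semiD _ _) (lerD ab cd).
  by rewrite semiZ.
rewrite mulrDl mul1r -[leLHS]add0r lerD // mulr_suml ler_sum // => i _.
rewrite mulrC ler_wpM2l ?semi_ge0 // [leRHS]/normr /= mx_normrE.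
by apply/bigmax_geP; right; exists (0, i).
Qed.

Lemma semi_continuous : continuous p.
Proof.
have [C C0 pC] := semi_le_mx_norm.
move=> x; apply: cvg_mx_norm => e e0.
exists (e / C) => [|z xz]; first exact: divr_gt0.
apply: le_trans (semi_dist _ _) (le_trans (pC _) _).
by rewrite mulrC -ler_pdivlMr // ltW.
Qed.

End Seminorm.

(** On the compact unit sphere of the max norm, [N] attains a minimum, positive by definiteness; its
    inverse is the constant, and homogeneity extends the bound to all [x]. *)
Lemma mx_norm_le_norm {k} {N : 'rV[R]_k -> R} : is_norm N ->
  exists2 C, 0 < C & forall x, `|x| <= C * N x.
Proof.
move=> nN; have sN := norm_seminorm nN.
pose S := [set x : 'rV[R]_k | `|x| = 1].
(* An empty sphere occurs only in dimension 0, where every vector is 0 and any constant works. *)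
have [S0|/set0P/negP/negPn/eqP S0] := pselect (S !=set0); last first.
  exists 1; first exact: ltr01.
  move=> x; have [->|x0] := eqVneq x 0; first by rewrite normr0 (semi0 sN) mulr0.
  suff : S (`|x|^-1 *: x) by rewrite S0.
  by rewrite /S /= normrZ normfV normr_id mulVf // normr_eq0.
have [||c] := EVT_min_rV S0 (f := N).
- apply: bounded_closed_compact.
    by exists 1; split; [exact: num_real|move=> M /ltW M1 x /= ->].
  apply: (closed_comp (f := fun x : 'rV[R]_k => `|x|) (D := [set 1])).
    by move=> x _; exact: norm_continuous.
  exact: closed_eq.
- by apply: continuous_subspaceT; exact: semi_continuous.
rewrite inE /S /= => c1 cmin.
have Nc : 0 < N c.
  rewrite lt_neqAle (semi_ge0 sN) andbT; apply/negP => /eqP Nc0.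
  case: nN => _ /(_ c (esym Nc0)) c0 _ _.
  by move: c1; rewrite c0 normr0 => /esym/eqP; rewrite oner_eq0.
exists (N c)^-1; first by rewrite invr_gt0.
move=> x; rewrite mulrC ler_pdivlMr //.
have [->|x0] := eqVneq x 0; first by rewrite normr0 mul0r (semi0 sN).
have nx : 0 < `|x| by rewrite normr_gt0.
have := cmin (`|x|^-1 *: x); rewrite inE /S /= normrZ normfV normr_id mulVf ?gt_eqF //.
by move=> /(_ erefl); rewrite (semiZ sN) normfV normr_id mulrC ler_pdivlMr // mulrC.
Qed.

Lemma norm_ball_compact {k} {N : 'rV[R]_k -> R} {r} : is_norm N ->
  compact [set x | N x <= r].
Proof.
move=> nN; have [C C0 NC] := mx_norm_le_norm nN.
apply: bounded_closed_compact.
  exists (C * r); split; first exact: num_real.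
  move=> M /ltW rM x /= xr; apply: le_trans (NC x) (le_trans _ rM).
  by rewrite ler_pM2l.
apply: (closed_comp (f := N) (D := [set z | z <= r])); last exact: closed_le.
by move=> x _; exact: (semi_continuous (norm_seminorm nN)).
Qed.

(** Continuity is phrased through [N] itself, the form in which a derivative estimate supplies it;
    norm equivalence turns it into topological continuity. *)
Lemma norm_ball_min {k} {N f : 'rV[R]_k -> R} {r} :
  is_norm N -> 0 <= r ->
  (forall x, N x <= r -> forall e, 0 < e -> exists2 d, 0 < d &
     forall h, N h <= d -> `|f (x + h) - f x| <= e) ->
  exists2 c, N c <= r & forall x, N x <= r -> f c <= f x.
Proof.
move=> nN r0 cf; have sN := norm_seminorm nN.
have [||| c] := @EVT_min_rV R k f [set x | N x <= r].
- by exists 0; rewrite /= (semi0 sN).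
- exact: norm_ball_compact.
- apply: continuous_in_subspaceT => x; rewrite inE /= => xr.
  have [C C0 NC] := semi_le_mx_norm sN.
  apply: cvg_mx_norm => e e0; have [d d0 fd] := cf x xr e e0.
  exists (d / C) => [|z xz]; first exact: divr_gt0.
  rewrite distrC -{1}(subrKC x z); apply: fd.
  by apply: le_trans (NC _) _; rewrite mulrC -ler_pdivlMr // distrC ltW.
- rewrite inE /= => cr cm; exists c => // x xr; by apply: cm; rewrite inE.
Qed.

(** Rescale [x] to the unit sphere. The dominating seminorm [q] bounds the set above, so its [sup]
    is a true upper bound. Only positive homogeneity is asked of [p], so that linear forms and norms
    are both covered. *)
Lemma le_sup_sphere {k} {N q p : 'rV[R]_k -> R} : is_norm N -> seminorm q ->
  (forall x, p x <= q x) -> (forall a x, 0 <= a -> p (a *: x) = a * p x) ->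
  forall x, p x <= sup [set p x | x in [set x | N x = 1]] * N x.
Proof.
move=> nN sq pq pZ x; have sN := norm_seminorm nN.
have [->|x0] := eqVneq x 0.
  by rewrite -(scale0r 0) pZ // mul0r scale0r (semi0 sN) mulr0.
have Nx : 0 < N x.
  rewrite lt_neqAle (semi_ge0 sN) andbT; apply: contra_neq x0 => Nx0.
  by case: nN => _ /(_ x (esym Nx0)).
rewrite -ler_pdivrMr // mulrC -pZ ?invr_ge0 ?(semi_ge0 sN) //.
apply: ub_le_sup; last first.
  exists ((N x)^-1 *: x) => //=.
  by rewrite (semiZ sN) ger0_norm ?invr_ge0 ?(semi_ge0 sN) // mulVf ?gt_eqF.
have [C C0 NC] := mx_norm_le_norm nN; have [D D0 qD] := semi_le_mx_norm sq.
exists (D * C) => _ [z /= z1 <-]; apply: le_trans (pq z) (le_trans (qD z) _).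
by rewrite ler_pM2l //; have := NC z; rewrite z1 mulr1.
Qed.

Lemma le_op_norm {n m} {Nn : 'rV[R]_n -> R} {Nm : 'rV[R]_m -> R} : is_norm Nn -> is_norm Nm ->
  forall (A : 'M_(n, m)) x, Nm (x *m A) <= op_norm Nn Nm A * Nn x.
Proof.
move=> nNn nNm A; have sNm := norm_seminorm nNm.
have sA : seminorm (fun x => Nm (x *m A)).
  split=> [x|a x|x z]; first exact: semi_ge0.
    by rewrite -scalemxAl (semiZ sNm).
  by rewrite mulmxDl; exact: semiD.
apply: (le_sup_sphere nNn sA (p := fun x => Nm (x *m A))) => // a x a0.
by rewrite -scalemxAl (semiZ sNm) ger0_norm.
Qed.

(** * The pairing, duality and solvability of a linear equation *)

Lemma pairingDr {k} (c x y : 'rV[R]_k) :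
  pairing c (x + y) = pairing c x + pairing c y.
Proof. by rewrite -big_split; apply: eq_bigr => i _; rewrite mxE mulrDr. Qed.

Lemma pairingZr {k} (c : 'rV[R]_k) a x : pairing c (a *: x) = a * pairing c x.
Proof. by rewrite /pairing mulr_sumr; apply: eq_bigr => i _; rewrite mxE mulrCA. Qed.

Lemma pairingC {k} (c x : 'rV[R]_k) : pairing c x = pairing x c.
Proof. by apply: eq_bigr => i _; rewrite mulrC. Qed.

Lemma pairing_subr_sqr {k} (w v : 'rV[R]_k) :
  pairing (w - v) (w - v) = pairing w w - 2 * pairing w v + pairing v v.
Proof.
rewrite /pairing mulr_sumr -sumrB -big_split /=.
by apply: eq_bigr => i _; rewrite !mxE; ring.
Qed.

Lemma pairing_mx {k} (c x : 'rV[R]_k) : pairing c x = (c *m x^T) 0 0.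
Proof. by rewrite mxE; apply: eq_bigr => i _; rewrite mxE. Qed.

Lemma pairing_mulmx {n m} (A : 'M[R]_(n, m)) h x :
  pairing (h *m A^T) x = pairing h (x *m A).
Proof. by rewrite !pairing_mx trmx_mul mulmxA. Qed.

Lemma pairing_gt0 {k} (c : 'rV[R]_k) : c != 0 -> 0 < pairing c c.
Proof.
move=> c0; rewrite lt_neqAle sumr_ge0 ?andbT => [|i _]; last exact: sqr_ge0.
apply: contra_neq c0 => /esym/eqP.
rewrite psumr_eq0 => [/allP c0|i _]; last exact: sqr_ge0.
apply/rowP => i; have := c0 i; rewrite mem_index_enum mulf_eq0 orbb mxE.
by move=> /(_ isT)/eqP.
Qed.

Lemma pairing_le_dual {k} {N : 'rV[R]_k -> R} : is_norm N ->
  forall c x, pairing c x <= dual_norm N c * N x.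
Proof.
move=> nN c; have sc : seminorm (fun x => `|pairing c x|).
  split=> [x|a x|x y]; first exact: normr_ge0.
    by rewrite pairingZr normrM.
  by rewrite pairingDr ler_normD.
apply: (le_sup_sphere nN sc (p := pairing c)) => [x|a x _]; first exact: ler_norm.
exact: pairingZr.
Qed.

(* The image of a ball is compact and convex; a point [z] outside it
   is strictly separated from it by [z - p], [p] being the Euclidean
   projection of [z]. *)
Lemma dual_bound_solve {n m} {Nn : 'rV[R]_n -> R} {Nm : 'rV[R]_m -> R}
    {A : 'M[R]_(n, m)} {mu} : is_norm Nn -> is_norm Nm -> 0 < mu ->
  (forall h, mu * dual_norm Nm h <= dual_norm Nn (h *m A^T)) ->
  forall z, exists2 x, x *m A = z & mu * Nn x <= Nm z.
Proof.
move=> nNn nNm mu0 muA z; have sNn := norm_seminorm nNn.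
have sNm := norm_seminorm nNm.
(* The norm bound on the solution says exactly that it lies in the ball of radius [r]. *)
pose r := Nm z / mu; have r0 : 0 <= r by rewrite divr_ge0 ?(semi_ge0 sNm) ?ltW.
(* Squared Euclidean distance from [z] to the image point [x *m A]. *)
pose f x := pairing (z - x *m A) (z - x *m A).
have fD x h : f (x + h) = f x - 2 * pairing (z - x *m A) (h *m A) +
                          pairing (h *m A) (h *m A).
  by rewrite /f mulmxDl opprD addrA; exact: pairing_subr_sqr.
have fc : continuous f.
  move=> x; have Fx := nbhs_filter x; apply: (cvg_big add_continuous) => i _.
  suff c : (fun v => (z - v *m A) 0 i) @ x --> (z - x *m A) 0 i by exact: cvgM.
  rewrite mxE; under eq_fun do rewrite mxE.
  apply: cvgD; first exact: cvg_cst.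
  rewrite mxE; under eq_fun do rewrite mxE.
  apply: cvgN; rewrite mxE; under eq_fun do rewrite mxE.
  apply: (cvg_big add_continuous) => j _.
  apply: cvgM; [exact: coord_continuous|exact: cvg_cst].
have [|||x] := @EVT_min_rV R n f [set x | Nn x <= r].
- by exists 0; rewrite /= (semi0 sNn).
- exact: norm_ball_compact.
- exact: continuous_subspaceT.
rewrite inE /= => xr fx.
exists x; last by rewrite mulrC -ler_pdivlMr.
apply/eqP; apply: contraT => xz; set h := z - x *m A.
have h0 : 0 < pairing h h by apply: pairing_gt0; rewrite subr_eq0 eq_sym.
(* Variational inequality for the projection: the linear form [h] is maximal over the image of the
   ball at [x *m A]. *)
have hx v : Nn v <= r -> pairing h (v *m A) <= pairing h (x *m A).
  move=> vr; pose d := v - x.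
  suff : pairing h (d *m A) <= 0.
    by rewrite /d mulmxBl -scaleN1r pairingDr pairingZr; lra.
  rewrite leNgt; apply/negP => a0; set a := pairing h _ in a0.
  pose Q := pairing (d *m A) (d *m A).
  have Q0 : 0 <= Q by apply: sumr_ge0 => i _; exact: sqr_ge0.
  (* Since [t <= 1], the point [x + t *: d] stays in the ball by convexity, while [f] changes by [-
     2 * t * a + t ^+ 2 * Q = - t * a * (1 + t) < 0]. *)
  pose t := a / (a + Q).
  have aQ : 0 < a + Q by lra.
  have t0 : 0 < t by rewrite divr_gt0.
  have t1 : t <= 1 by rewrite ler_pdivrMr // mul1r; lra.
  have ta : t * (a + Q) = a by rewrite divfK // gt_eqF.
  have := fx (x + t *: d); rewrite inE /= => /(_ _).
  rewrite fD -/h -scalemxAl !pairingZr (pairingC (t *: _)) pairingZr -/a -/Q.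
  have xd : x + t *: d = (1 - t) *: x + t *: v.
    by rewrite /d scalerBr scalerBl scale1r addrA addrAC.
  have -> : Nn (x + t *: d) <= r.
    rewrite xd; apply: le_trans (semiD sNn _ _) _.
    rewrite !(semiZ sNn) (ger0_norm (ltW t0)) ger0_norm ?subr_ge0 //; nra.
  move=> /(_ isT); nra.
(* This would give [pairing h h <= 0]. By duality and the hypothesis on [A^T], [pairing h z] is at
   most [r] times the dual norm of [h *m A^T], which [hx] bounds by rescaling unit vectors to radius
   [r]. *)
suff : pairing h z <= pairing h (x *m A).
  by rewrite -(subrK (x *m A) z) -/h pairingDr; lra.
apply: le_trans (pairing_le_dual nNm h z) _.
have -> : Nm z = mu * r by rewrite mulrC divfK // gt_eqF.
rewrite mulrCA mulrA; apply: le_trans (ler_wpM2r r0 (muA h)) _.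
have s0 : 0 <= pairing h (x *m A).
  have := hx 0; rewrite (semi0 sNn) mul0mx => /(_ r0); apply: le_trans.
  by rewrite /pairing big1 // => i _; rewrite [X in _ * X]mxE mulr0.
have [->|rn0] := eqVneq r 0; first by rewrite mulr0.
have {rn0}rp : 0 < r by rewrite lt_neqAle eq_sym rn0.
rewrite -ler_pdivlMr // /dual_norm.
set S := (X in sup X).
(* In dimension 0 the unit sphere is empty and [sup] takes its default value 0, so [s0] suffices. *)
have [S0|/set0P/negP/negPn/eqP ->] := pselect (S !=set0); last first.
  by rewrite sup0 divr_ge0 // ltW.
apply: ge_sup => // _ [v /= v1 <-].
rewrite ler_pdivlMr // mulrC -pairingZr pairing_mulmx; apply: hx.
by rewrite (semiZ sNn) v1 mulr1 ger0_norm.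
Qed.

End NormLemmas.

(** * Solving the nonlinear equation by minimising a penalised residual *)

(* Row-vector convention: g'(x) is the matrix J x : 'M_(n,m) acting by
   h |-> h *m J x; hence g'(0)^T h corresponds to h *m (J 0)^T. *)
Theorem theorem2 (R : realType) (n m : nat)
  (Nn : 'rV[R]_n -> R) (Nm : 'rV[R]_m -> R)
  (g : 'rV[R]_n -> 'rV[R]_m) (J : 'rV[R]_n -> 'M[R]_(n, m))
  (y : 'rV[R]_m) (rho L mu0 : R) :
  is_norm Nn -> is_norm Nm ->
  0 < rho -> 0 < L -> 0 < mu0 ->
  (* (A) *)
  g 0 = 0 ->
  (forall x, Nn x <= rho -> has_derivative_at Nn Nm g x (J x)) ->
  (forall xa xb, Nn xa <= rho -> Nn xb <= rho ->
     op_norm Nn Nm (J xa - J xb) <= L * Nn (xa - xb)) ->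
  (* (B') *)
  (forall h : 'rV[R]_m,
     dual_norm Nn (h *m (J 0)^T) >= mu0 * dual_norm Nm h) ->
  (* (C') *)
  Nm y < mu0 ^+ 2 / (4 * L) ->
  mu0 / (2 * L) <= rho ->
  exists xstar : 'rV[R]_n, g xstar = y /\ Nn xstar <= 2 * Nm y / mu0.
Proof.
move=> nNn nNm rho0 L0 mu00 g0 gJ JL JB yB rhoB.
have sNn := norm_seminorm nNn; have sNm := norm_seminorm nNm.
pose phi x := Nm (y - g x) + mu0 / 2 * Nn x.
have [||x xrho phix] := norm_ball_min (f := phi) (r := rho) nNn; first exact: ltW.
  move=> x xrho e e0.
  (* A local Lipschitz constant of [phi] at [x]: the 1 is the derivative remainder taken with
     [eps = 1], and [mu0 / 2] comes from the penalty term. *)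
  pose D := 1 + `|op_norm Nn Nm (J x)| + mu0 / 2.
  have D0 : 0 < D by rewrite /D; have := normr_ge0 (op_norm Nn Nm (J x)); lra.
  have [d d0 dP] := gJ x xrho 1 ltr01.
  exists (minr d (e / D)); first by rewrite lt_min d0 divr_gt0.
  move=> h; rewrite le_min ler_pdivlMr // => /andP[/dP hd hD].
  have gh : Nm (g (x + h) - g x) <= (1 + `|op_norm Nn Nm (J x)|) * Nn h.
    rewrite -(subrK (h *m J x) (g (x + h) - g x)) mulrDl.
    apply: le_trans (semiD sNm _ _) (lerD hd _).
    apply: le_trans (le_op_norm nNn nNm _ _) _.
    by rewrite ler_wpM2r ?ler_norm ?(semi_ge0 sNn).
  have := semi_dist sNm (y - g (x + h)) (y - g x).
  have -> : y - g (x + h) - (y - g x) = - (g (x + h) - g x).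
    by apply/rowP => i; rewrite !mxE; ring.
  have := semi_dist sNn (x + h) x.
  rewrite addrAC subrr add0r (semiN sNm) => Nxh /le_trans /(_ gh) gxh.
  move: Nxh gxh hD; rewrite /phi /D !ler_norml => /andP[? ?] /andP[? ?] ?.
  apply/andP; split; nra.
have xy : Nn x <= 2 * Nm y / mu0.
  have := phix 0; rewrite (semi0 sNn) (ltW rho0) /phi g0 subr0 (semi0 sNn).
  move=> /(_ isT); have := semi_ge0 sNm (y - g x).
  rewrite ler_pdivlMr //; lra.
exists x; split=> //; apply/eqP; apply: contraT => gxy.
have w0 : 0 < Nm (y - g x).
  rewrite lt_neqAle (semi_ge0 sNm) andbT; apply: contra_neq gxy => w0.
  case: nNm => _ /(_ _ (esym w0)) /eqP + _ _.
  by rewrite subr_eq0 => /eqP.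
have [u uw uN] := dual_bound_solve nNn nNm mu00 JB (y - g x).
have u0 : 0 < Nn u.
  rewrite lt_neqAle (semi_ge0 sNn) andbT; apply: contraTneq w0 => un.
  case: nNn => _ /(_ _ (esym un)) u0 _ _.
  by rewrite -uw u0 mul0mx (semi0 sNm) ltxx.
have Lx : L * Nn x < mu0 / 2.
  move: xy yB; rewrite ler_pdivlMr // ltr_pdivlMr ?mulr_gt0 // expr2; nra.
have xrho' : Nn x < rho.
  apply: lt_le_trans rhoB; rewrite ltr_pdivlMr ?mulr_gt0 //; lra.
(* Guaranteed first-order rate of decrease of [phi] along [u]; it is positive because
   [mu0 * Nn u <= Nm (y - g x)] and [L * Nn x < mu0 / 2]. *)
pose gam := Nm (y - g x) - (mu0 / 2 + L * Nn x) * Nn u.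
have gam0 : 0 < gam by rewrite /gam; nra.
(* With this tolerance the derivative remainder uses up only half of the decrease [t * gam]. *)
pose e := gam / (2 * Nn u).
have e0 : 0 < e by rewrite divr_gt0 // mulr_gt0.
have eu : 2 * (e * Nn u) = gam.
  by rewrite /e; field; rewrite gt_eqF.
have [d d0 dP] := gJ x xrho e e0.
(* The three bounds make [1 - t] nonnegative, put the step within reach of the derivative estimate,
   and keep [x + t *: u] in the ball. *)
pose t := minr 1 (minr d (rho - Nn x) / Nn u).
have t0 : 0 < t by rewrite lt_min ltr01 divr_gt0 // lt_min d0 subr_gt0.
have [t1 td tr] : [/\ t <= 1, t * Nn u <= d & t * Nn u <= rho - Nn x].
  have : t <= minr 1 (minr d (rho - Nn x) / Nn u) by [].
  by rewrite le_min ler_pdivlMr // le_min => /and3P[].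
have Ntu : Nn (t *: u) = t * Nn u by rewrite (semiZ sNn) gtr0_norm.
have xtu : Nn (x + t *: u) <= Nn x + t * Nn u.
  by rewrite -Ntu; exact: (semiD sNn).
have res : Nm (y - g (x + t *: u)) <=
    (1 - t) * Nm (y - g x) + t * (L * Nn x * Nn u) + t * (e * Nn u).
  (* Since [u *m J 0 = y - g x], replacing [J x] by [J 0] cancels the fraction [t] of the residual,
     at a cost controlled by the Lipschitz bound between [x] and 0. *)
  have -> : y - g (x + t *: u) = (1 - t) *: (y - g x) +
      (- (t *: u *m (J x - J 0)) - (g (x + t *: u) - g x - t *: u *m J x)).
    rewrite mulmxBr -[t *: u *m J 0]scalemxAl uw scalerBl scale1r.
    by apply/rowP => i; rewrite !mxE; ring.
  rewrite -[leRHS]addrA; apply: le_trans (semiD sNm _ _) (lerD _ _).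
    by rewrite (semiZ sNm) ger0_norm ?subr_ge0.
  apply: le_trans (semiD sNm _ _) _; rewrite !(semiN sNm); apply: lerD.
    apply: le_trans (le_op_norm nNn nNm _ _) _.
    have := JL x 0 xrho; rewrite (semi0 sNn) subr0 Ntu => /(_ (ltW rho0)) JLx.
    by rewrite [leRHS]mulrCA ler_wpM2r // mulr_ge0 ?ltW.
  by have := dP (t *: u); rewrite Ntu => /(_ td); rewrite mulrCA.
have := phix (x + t *: u); rewrite /phi.
have -> : Nn (x + t *: u) <= rho by lra.
move=> /(_ isT) hmin.
(* Minimality at [x] forces [gam <= e * Nn u], which is [gam / 2]: a contradiction. *)
have : t * gam <= t * (e * Nn u) by rewrite /gam; nra.
rewrite ler_pM2l //; lra.
Qed.
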